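(* There is a function $h(n)=\Theta(n)$ such that for every natural number $n$ and every set $V$ of $n$ points in general position in the plane, $\alpha(D_V(n))\ge \frac{n^2}{6}-h(n)$.
   Context: A set of points in the plane is in general position if no three are collinear. For such a set $V$ of $n$ points, the segment disjointness graph $D_V(n)$ has as vertices all closed straight-line segments with both endpoints in $V$, two segments being adjacent iff they are disjoint (no common point, including endpoints). An $l$-coloring of a graph $G$ is a surjective map $V(G)\to[l]$; it is proper if adjacent vertices get different colors and complete if for every two distinct colors $i,j$ there is an edge with endpoints colored $i$ and $j$. The achromatic number $\alpha(G)$ is the largest $l$ admitting a proper complete $l$-coloring. The paper writes the bound as $\frac{n^2}{6}-\Theta(n)\le \alpha(D_V(n))$. *)

(* Defs.v *)
From HB Require Import structures.
From mathcomp Require Import all_boot all_order all_algebra finmap.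
From mathcomp Require Import all_classical all_reals all_analysis.
Set Implicit Arguments.
Unset Strict Implicit.
Unset Printing Implicit Defensive.
Import Order.TTheory GRing.Theory Num.Theory.
Import numFieldNormedType.Exports.

Local Open Scope classical_set_scope.
Local Open Scope ring_scope.

Section Colorings.
Variables (G : finType) (adj : rel G) (l : nat).
Implicit Type c : {ffun G -> 'I_l}.

Definition surjective_coloring c : bool := [forall i, exists x, c x == i].

Definition proper_coloring c : bool :=
  [forall x, forall y, adj x y ==> (c x != c y)].

Definition complete_coloring c : bool :=
  [forall i, forall j, (i != j) ==>
    [exists x, exists y, [&& adj x y, c x == i & c y == j]]].

Definition has_proper_complete_coloring : bool :=
  [exists c : {ffun G -> 'I_l},
    [&& surjective_coloring c, proper_coloring c & complete_coloring c]].

End Colorings.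

(* The bound l <= #|G| loses nothing, since the colorings are surjective. *)
Definition achromatic_number (G : finType) (adj : rel G) : nat :=
  \max_(l < #|G|.+1 | has_proper_complete_coloring adj l) l.

Definition plane (R : realType) := 'rV[R]_2.

Definition line (R : realType) (p d : plane R) : set (plane R) :=
  [set p + t *: d | t in [set: R]].

Definition collinear (R : realType) (A : set (plane R)) : Prop :=
  exists p d : plane R, d != 0 /\ A `<=` line p d.

Definition general_position (R : realType) (V : {fset plane R}) : Prop :=
  forall p q r : plane R, p \in V -> q \in V -> r \in V ->
    p != q -> q != r -> p != r -> ~ collinear [set p; q; r].

Definition segment (R : realType) (p q : plane R) : set (plane R) :=
  [set (1 - t) *: p + t *: q | t in `[0 : R, 1]].

(* The vertices of the segment disjointness graph are the segments themselves,
   as point sets, so that segment p q and segment q p are the same vertex.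
   Single points (p = q) are not segments. *)
Definition segments (R : realType) (V : {fset plane R}) :
    {fset set (plane R)} :=
  [fset segment p q | p in V, q in V & p != q]%fset.

Definition disjoint_segments (R : realType) (V : {fset plane R}) :
    rel (segments V) :=
  fun s t => `[< val s `&` val t = set0 >].

(* Main.v *)
(* Identify V with Z/n. A triple of distinct elements of Z/n with sum 0 is
   determined by any two of its elements, so these triples, of which there are
   at least (n^2 - 3n)/6, are edge-disjoint triangles on V. Two triangles
   sharing at most one vertex have disjoint edges: the line through two
   vertices of one misses the vertices of the other, hence crosses at most two
   of its sides. So the triangles are the classes of a partial proper complete
   coloring, which extends to all segments without losing colors. *)
Require Import Defs.
From HB Require Import structures.
From mathcomp Require Import all_boot all_order all_algebra finmap.
From mathcomp Require Import all_classical all_reals all_analysis.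
From mathcomp Require Import zify ring lra.
Import Order.TTheory GRing.Theory Num.Theory.
Import numFieldNormedType.Exports.
Local Open Scope classical_set_scope.
Local Open Scope ring_scope.

(** * Lower bounds on the achromatic number from partial colorings *)

Section Achromatic.
Variables (G : finType) (adj : rel G).

(** Colors are taken among the vertices of [G], so that merging two colors needs no renumbering.
    Ranking the image of [c] turns it into a surjective coloring by an initial segment of the
    naturals. *)
Lemma achromatic_number_ge_image (c : {ffun G -> G}) :
  (forall x y, adj x y -> c x != c y) ->
  (forall a b, a \in codom c -> b \in codom c -> a != b ->
     exists x y, [/\ adj x y, c x = a & c y = b]) ->
  (#|codom c| <= achromatic_number adj)%N.
Proof.
move=> cP cC; set A := mem (codom c).
pose k x : 'I_#|A| := enum_rank_in (codom_f c x : c x \in A) (c x).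
have kE x : enum_val (k x) = c x by rewrite enum_rankK_in // codom_f.
have lA : (#|A| < #|G|.+1)%N by rewrite ltnS max_card.
apply: (@leq_bigmax_cond _ _ _ (Ordinal lA)) => /=.
apply/existsP; exists [ffun x => k x]; apply/and3P; split.
- apply/forallP => i; have /codomP[x xE] := enum_valP i.
  by apply/existsP; exists x; rewrite ffunE -(inj_eq enum_val_inj) kE xE.
- apply/forallP => x; apply/forallP => y; apply/implyP => xy.
  by rewrite !ffunE -(inj_eq enum_val_inj) !kE cP.
- apply/forallP => i; apply/forallP => j; apply/implyP => ij.
  have [||| x [y [xy xi yj]]] := cC (enum_val i) (enum_val j).
  + exact: enum_valP.
  + exact: enum_valP.
  + by rewrite (inj_eq enum_val_inj).
  apply/existsP; exists x; apply/existsP; exists y.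
  by rewrite xy !ffunE -!(inj_eq enum_val_inj) !kE xi yj !eqxx.
Qed.

(* Among the proper colorings that are constant on every class, one with the
   fewest colors is complete, since two colors without an edge between them
   could be merged. It still separates the classes. *)
Lemma achromatic_number_ge_family (I : finType) (T : I -> {set G}) :
  symmetric adj ->
  (forall i, exists x, x \in T i) ->
  (forall i j x, x \in T i -> x \in T j -> i = j) ->
  (forall i x y, x \in T i -> y \in T i -> ~~ adj x y) ->
  (forall i j, i != j -> exists x y, [/\ x \in T i, y \in T j & adj x y]) ->
  irreflexive adj ->
  (#|I| <= achromatic_number adj)%N.
Proof.
move=> adjC T0 Tdisj Tind Tadj adjI.
pose good (c : {ffun G -> G}) :=
  [forall x, forall y, adj x y ==> (c x != c y)] &&
  [forall i, forall x in T i, forall y in T i, c x == c y].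
have goodP (c : {ffun G -> G}) : reflect ((forall x y, adj x y -> c x != c y) /\
    (forall i x y, x \in T i -> y \in T i -> c x = c y)) (good c).
  apply: (iffP andP) => -[cP cT]; split.
  - by move=> x y xy; have /forallP/(_ y)/implyP := forallP cP x; apply.
  - move=> i x y xi yi; have /forall_inP/(_ x xi) := forallP cT i.
    by move=> /forall_inP/(_ y yi)/eqP.
  - by apply/forallP => x; apply/forallP => y; apply/implyP/cP.
  - apply/forallP => i; apply/forall_inP => x xi; apply/forall_inP => y yi.
    by rewrite (cT i x y).
pose rep i := xchoose (T0 i).
have repP i : rep i \in T i by exact: xchooseP.
(* A first good coloring: a vertex of a class gets the representative of that class, and any other
   vertex is its own color. The two kinds of colors never clash, since representatives lie in
   classes. *)
pose c0 := [ffun x => if [pick i | x \in T i] is Some i then rep i else x].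
have c0T i x : x \in T i -> c0 x = rep i.
  by move=> xi; rewrite ffunE; case: pickP => [j xj|/(_ i)]; rewrite ?xi// (Tdisj _ _ _ xj xi).
have c0N x : (forall i, x \notin T i) -> c0 x = x.
  by move=> xN; rewrite ffunE; case: pickP => // i; rewrite (negPf (xN i)).
have good0 : good c0.
  apply/goodP; split=> [x y xy|i x y xi yi]; last by rewrite !(c0T i).
  apply/eqP => c0xy.
  have [/existsP[i xi]|/existsPn xN] := boolP [exists i, x \in T i];
  have [/existsP[j yj]|/existsPn yN] := boolP [exists i, y \in T i].
  - move: c0xy; rewrite (c0T i)// (c0T j)// => rij.
    have ij : i = j by apply: (Tdisj i j (rep i)); rewrite // rij.
    by move: xy; rewrite (negPf (Tind i x y xi _)) // ij.
  - by move: (yN i); rewrite -(c0N y yN) -c0xy (c0T i)// repP.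
  - by move: (xN j); rewrite -(c0N x xN) c0xy (c0T j)// repP.
  - by move: xy; rewrite -(c0N x xN) c0xy (c0N y yN) adjI.
case: (arg_minnP (fun c : {ffun G -> G} => #|codom c|) good0) => c cgood cmin.
have [cP cT] := goodP _ cgood.
apply: (@leq_trans #|codom c|); last first.
  apply: achromatic_number_ge_image => // a b aA bA ab.
  have [/existsP[x /existsP[y /and3P[xy /eqP xa /eqP yb]]]|Nab] :=
    boolP [exists x, exists y, [&& adj x y, c x == a & c y == b]].
    by exists x, y.
  have Nedge x y : adj x y -> c x = a -> c y = b -> False.
    move=> xy xa yb; move: Nab => /existsPn/(_ x)/existsPn/(_ y).
    by rewrite xy xa yb !eqxx.
  (* Without an edge between colors [a] and [b], recoloring [b] by [a] stays proper and constant on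
     classes but loses the color [b], against minimality. *)
  pose c' := [ffun x => if c x == b then a else c x].
  have /cmin : good c'.
    apply/goodP; split=> [x y xy|i x y xi yi]; rewrite !ffunE; last first.
      by rewrite (cT i x y).
    have := cP _ _ xy.
    case: ifP => [/eqP xb|_]; case: ifP => [/eqP yb|_] //.
    - by rewrite xb yb eqxx.
    - move=> _; apply/eqP => ay; apply: (Nedge y x) => //.
      by rewrite adjC.
    - by move=> _; apply/eqP => xa; apply: (Nedge x y).
  rewrite leqNgt => /negP[]; apply: proper_card; apply/properP; split.
    apply/fintype.subsetP => _ /codomP[x ->]; rewrite ffunE.
    by case: ifP => // _; exact: codom_f.
  exists b => //; apply/negP => /codomP[x]; rewrite ffunE.
  by case: eqP => [_ /esym/eqP|cb /esym //]; apply/negP.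
(* Distinct classes are joined by an edge, and [c] is proper and constant on each of them, so their
   representatives get distinct colors. *)
rewrite -(@card_codom _ _ (fun i => c (rep i))); last first.
  move=> i j cij; apply/eqP/negPn/negP => /Tadj[x [y [xi yj]]] /cP.
  by rewrite (cT i x (rep i)) // (cT j y (rep j)) // cij eqxx.
apply/subset_leq_card/fintype.subsetP => _ /codomP[i ->]; exact: codom_f.
Qed.

End Achromatic.

(** * Zero-sum triples in a finite abelian group *)

Section ZeroSumTriples.
Variable T : finZmodType.

Definition zero_sum_triples : {set {set T}} :=
  [set A : {set T} | (#|A| == 3) && (\sum_(i in A) i == 0)]%SET.

Lemma zero_sum_triple_eq (A B : {set T}) i j :
  A \in zero_sum_triples -> B \in zero_sum_triples -> i != j ->
  i \in A -> j \in A -> i \in B -> j \in B -> A = B.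
Proof.
move=> + + ij.
suff H (C : {set T}) : C \in zero_sum_triples -> i \in C -> j \in C ->
    C = [set i; j; - (i + j)]%SET.
  by move=> AS BS iA jA iB jB; rewrite (H A)// (H B).
rewrite inE => /andP[/eqP C3 /eqP Cs] iC jC.
have jCi : j \in (C :\ i)%SET by rewrite !inE eq_sym ij.
have : #|(C :\ i :\ j)%SET| == 1%N.
  by move: C3; rewrite (cardsD1 i) iC (cardsD1 j) jCi !add1n => -[->].
move=> /cards1P[k Ck].
have Cijk : C = (i |: (j |: [set k]))%SET by rewrite -Ck !finset.setD1K.
move: Cs; rewrite (big_setD1 i)//= (big_setD1 j)//= Ck big_set1 addrA.
by move=> /eqP; rewrite addrC addr_eq0 => /eqP kE; rewrite Cijk kE finset.setUA.
Qed.

(** Double counting of the ordered pairs (i, j) for which i, j and -(i + j) are pairwise distinct: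
    all but at most 3|T| pairs qualify, and at most six of them yield the same triple. *)
Lemma card_zero_sum_triples :
  (#|T| ^ 2 <= 6 * #|zero_sum_triples| + 3 * #|T|)%N.
Proof.
pose third (u : T * T) := - (u.1 + u.2).
pose P := [set u : T * T | [&& u.1 != u.2, u.1 != third u & u.2 != third u]]%SET.
have PC : (#|(~: P)%SET| <= 3 * #|T|)%N.
  pose D f := [set f i | i : T]%SET : {set T * T}.
  have DT f : (#|D f| <= #|T|)%N by exact: leq_imset_card.
  (* A bad pair satisfies i = j, j = -2i or i = -2j, so it lies on one of three graphs of functions
     on [T]. *)
  apply: (@leq_trans #|(D (fun i => (i, i)) :|: D (fun i => (i, - i - i))
                        :|: D (fun i => (- i - i, i)))%SET|).
    apply/subset_leq_card/fintype.subsetP => -[i j].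
    rewrite !inE /third /= !negb_and !negbK => /or3P[] /eqP ij.
    - by rewrite ij imset_f ?inE.
    - suff -> : j = - i - i by rewrite (imset_f (fun i => (i, - i - i))) ?inE ?orbT.
      by rewrite [X in - X - _]ij opprK addrAC subrr add0r.
    - suff -> : i = - j - j by rewrite (imset_f (fun i => (- i - i, i))) ?inE ?orbT.
      by rewrite [X in - X - _]ij opprK addrK.
  have := DT (fun i => (i, i)); have := DT (fun i => (i, - i - i)).
  have := DT (fun i => (- i - i, i)).
  move=> d1 d2 d3; rewrite (leq_trans (leq_card_setU _ _))//.
  rewrite mulSn addnC leq_add// (leq_trans (leq_card_setU _ _))//.
  by rewrite mul2n -addnn leq_add.
pose tr (u : T * T) := [set u.1; u.2; third u]%SET.
have trP u : u \in P -> tr u \in zero_sum_triples.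
  case: u => i j; rewrite !inE /tr /third /= => /and3P[ij ik jk].
  have nij : i \notin [set j; - (i + j)]%SET by rewrite !inE negb_or ij.
  rewrite -finset.setUA cardsU1 nij cards2 jk /=.
  by rewrite big_setU1//= big_setU1 ?inE//= big_set1 addrA subrr.
have PS : (#|P| <= 6 * #|zero_sum_triples|)%N.
  rewrite -sum1_card (partition_big tr (mem zero_sum_triples)) //=.
  rewrite mulnC -sum_nat_const leq_sum// => A; rewrite inE => /andP[/eqP A3 _].
  rewrite sum1_card.
  pose D := [set (i, i) | i in A]%SET.
  (* The pairs yielding [A] lie in the square of [A] minus its diagonal, which has 9 - 3
     elements. *)
  have -> : 6%N = #|(finset.setX A A :\: D)%SET|.
    have DA : D \subset finset.setX A A.
      by apply/fintype.subsetP => _ /imsetP[i iA ->]; rewrite inE /= iA.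
    rewrite cardsD (finset.setIidPr DA) cardsX A3.
    by rewrite card_imset ?A3// => i j [].
  apply/subset_leq_card/fintype.subsetP => -[i j]; rewrite !inE /= => /andP[].
  rewrite inE => /andP[/= ij _] /eqP <-.
  rewrite /tr !inE !eqxx ?orbT /= andbT; apply/imsetP => -[k _ [ik jk]].
  by rewrite ik jk eqxx in ij.
have := cardsC P; rewrite card_prod => PT.
by rewrite expnS expn1 -PT leq_add.
Qed.

End ZeroSumTriples.

(** * Orientation and disjointness of segments in the plane *)

Section Segments.
Variable R : realType.
Implicit Types (a b p q r s x y z : plane R) (V : {fset plane R}).

(** The cross product of b - a and x - a, that is, twice the signed area of the triangle a b x. Its
    sign tells on which side of the line through [a] and [b] the point [x] lies. *)
Definition orient a b x : R :=
  (b 0 0 - a 0 0) * (x 0 1 - a 0 1) - (b 0 1 - a 0 1) * (x 0 0 - a 0 0).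

Lemma orient_affine a b x y t :
  orient a b ((1 - t) *: x + t *: y) =
  (1 - t) * orient a b x + t * orient a b y.
Proof. by rewrite /orient !mxE; ring. Qed.

Lemma orient_segment a b x : segment a b x -> orient a b x = 0.
Proof.
case=> t _ <-; rewrite orient_affine.
have -> : orient a b a = 0 by rewrite /orient; ring.
have -> : orient a b b = 0 by rewrite /orient; ring.
by rewrite !mulr0 addr0.
Qed.

Lemma orient_eq0_collinear a b x :
  a != b -> orient a b x = 0 -> collinear [set a; b; x].
Proof.
move=> ab abx0; exists a, (b - a); split; first by rewrite subr_eq0 eq_sym.
have [t xE] : exists t, x = a + t *: (b - a).
  have row2 (u v : plane R) : u 0 0 = v 0 0 -> u 0 1 = v 0 1 -> u = v.
    move=> e0 e1; apply/rowP => i; case: i => -[|[|//]] i2.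
    - by have -> : Ordinal i2 = 0 by exact: val_inj.
    - by have -> : Ordinal i2 = 1 by exact: val_inj.
  (* The parameter of [x] on the line is found by dividing by a nonzero coordinate of b - a; the
     vertical line has to use the second one. *)
  have [b0|b0] := eqVneq (b 0 0 - a 0 0) 0.
    have b1 : b 0 1 - a 0 1 != 0.
      apply: contra_neq ab => b1; apply: row2; lra.
    have x0 : x 0 0 - a 0 0 = 0.
      move: abx0; rewrite /orient b0 mul0r sub0r => /eqP.
      by rewrite oppr_eq0 mulf_eq0 (negPf b1) => /eqP.
    exists ((x 0 1 - a 0 1) / (b 0 1 - a 0 1)).
    apply: row2; rewrite !mxE; last by field.
    by rewrite b0 mulr0; lra.
  exists ((x 0 0 - a 0 0) / (b 0 0 - a 0 0)).
  apply: row2; rewrite !mxE; first by field.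
  apply: (mulfI b0); rewrite mulrDr mulrA [X in _ + X * _]mulrC divfK //.
  by move: abx0; rewrite /orient; lra.
move=> _ [[->|->]|->]; [exists 0|exists 1|exists t] => //.
- by rewrite scale0r addr0.
- by rewrite scale1r addrC subrK.
Qed.

Lemma orient_neq0 V a b x : general_position V ->
  a \in V -> b \in V -> x \in V -> a != b -> b != x -> a != x ->
  orient a b x != 0.
Proof.
move=> Vgen aV bV xV ab bx ax; apply/eqP => /(orient_eq0_collinear _ _ _ ab).
exact: Vgen.
Qed.

(** Along the segment from [x] to [y], [orient a b] is a convex combination of two numbers of the
    same strict sign, so it never vanishes, whereas it is zero on the segment from [a] to [b]. *)
Lemma disjoint_segment_same_side a b x y :
  0 < orient a b x * orient a b y -> segment a b `&` segment x y = set0.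
Proof.
move=> xy; apply/seteqP; split=> // z [/orient_segment z0 [t t01 zE]].
move: t01; rewrite /= in_itv /= => /andP[t0 t1]; move: z0.
rewrite -zE orient_affine {zE}; move: xy.
set u := orient a b x; set v := orient a b y => uv z0.
clearbody u v; clear a b x y z.
have [u0|u0|u0] := ltrgt0P u.
- have v0 : 0 < v by rewrite -(pmulr_rgt0 _ u0).
  nra.
- have v0 : v < 0 by rewrite -(nmulr_rgt0 _ u0).
  nra.
- by move: uv; rewrite u0 mul0r ltxx.
Qed.

Lemma segment_left a b : segment a b a.
Proof.
exists 0; first by rewrite /= in_itv /= lexx ler01.
by rewrite subr0 scale1r scale0r addr0.
Qed.

Lemma segment_right a b : segment a b b.
Proof.
exists 1; first by rewrite /= in_itv /= lexx ler01.
by rewrite subrr scale1r scale0r add0r.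
Qed.

Lemma segment_endpoint V a b x : general_position V ->
  a \in V -> b \in V -> x \in V -> a != b -> segment a b x -> x = a \/ x = b.
Proof.
move=> Vgen aV bV xV ab /orient_segment/eqP abx.
have [->|bx] := eqVneq b x; first by right.
have [->|ax] := eqVneq a x; first by left.
by move: abx; rewrite (negPf (orient_neq0 _ _ _ _ Vgen aV bV xV ab bx ax)).
Qed.

(** Since graph vertices are bare point sets, endpoints must be recovered from the set: general
    position leaves no other point of [V] on a segment. *)
Lemma segment_endpoints_eq V a b c d : general_position V ->
  a \in V -> b \in V -> c \in V -> d \in V -> c != d ->
  segment a b = segment c d -> (a = c \/ a = d) /\ (b = c \/ b = d).
Proof.
move=> Vgen aV bV cV dV cd abcd; split; apply: (segment_endpoint V) => //.
  by rewrite -abcd; exact: segment_left.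
by rewrite -abcd; exact: segment_right.
Qed.

(* A line missing the vertices of a triangle leaves two of them on the same
   side, and hence misses the edge joining them. *)
Lemma triangle_edge_disjoint V a b x y z : general_position V ->
  [/\ a \in V, b \in V, x \in V, y \in V & z \in V] ->
  uniq [:: a; b; x; y; z] ->
  [\/ segment a b `&` segment x y = set0,
      segment a b `&` segment y z = set0 |
      segment a b `&` segment x z = set0].
Proof.
move=> Vgen [aV bV xV yV zV].
rewrite /= !inE !negb_or -!andbA.
move=> /and5P[ab ax ay az /and4P[bx bY bz _]].
have := orient_neq0 _ _ _ _ Vgen aV bV xV ab bx ax.
have := orient_neq0 _ _ _ _ Vgen aV bV yV ab bY ay.
have := orient_neq0 _ _ _ _ Vgen aV bV zV ab bz az.
move=> z0 y0 x0.
have [xy|xy] := ltP 0 (orient a b x * orient a b y).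
  by constructor 1; exact: disjoint_segment_same_side.
have [yz|yz] := ltP 0 (orient a b y * orient a b z).
  by constructor 2; exact: disjoint_segment_same_side.
constructor 3; apply: disjoint_segment_same_side.
rewrite lt_neqAle eq_sym mulf_neq0 //=.
move: x0 y0 z0 xy yz.
set u := orient a b x; set v := orient a b y; set w := orient a b z => u0 v0 w0.
(* Two sign changes cancel: u w v^2 = (u v)(v w) is a product of two nonpositive numbers, and v^2 >
   0. *)
move=> uv vw; rewrite -(@pmulr_lge0 _ (v * v)) ?mulr_ge0_le0//.
  have -> : u * w * (v * v) = (u * v) * (v * w) by ring.
  exact: mulr_le0.
by rewrite -expr2 exprn_even_gt0.
Qed.

End Segments.

(** * Zero-sum triangles as color classes *)

Section ZeroSumTriangles.
Variables (R : realType) (V : {fset plane R}) (T : finZmodType).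
Variable p : T -> plane R.
Hypothesis Vgen : general_position V.
Hypothesis pV : forall i, p i \in V.
Hypothesis p_inj : injective p.

Definition edges (A : {set T}) : {set segments V} :=
  [set s : segments V | `[< exists i j,
     [/\ i \in A, j \in A, i != j & val s = segment (p i) (p j)] >]]%SET.

Lemma edgesP (A : {set T}) (s : segments V) : reflect
  (exists i j, [/\ i \in A, j \in A, i != j & val s = segment (p i) (p j)])
  (s \in edges A).
Proof. by rewrite inE; exact: asboolP. Qed.

Lemma edge_exists i j (A : {set T}) : i \in A -> j \in A -> i != j ->
  exists2 s, s \in edges A & val s = segment (p i) (p j).
Proof.
move=> iA jA ij.
have sV : segment (p i) (p j) \in segments V.
  by apply/imfset2P; exists (p i); rewrite ?pV//; exists (p j) => //;
    rewrite !inE /= pV (inj_eq p_inj) ij.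
by exists [` sV]%fset => //; apply/edgesP; exists i, j.
Qed.

(** Two disjoint sides would have four distinct endpoints, but a triangle has only three
    vertices. *)
Lemma edges_intersect (A : {set T}) (s t : segments V) : #|A| = 3%N ->
  s \in edges A -> t \in edges A -> ~~ disjoint_segments s t.
Proof.
move=> A3 /edgesP[i [j [iA jA ij sE]]] /edgesP[k [l [kA lA kl tE]]].
apply/asboolP; rewrite sE tE => st0.
have NE x : segment (p i) (p j) x -> segment (p k) (p l) x -> False.
  by move=> xs xt; have : set0 x by rewrite -st0.
have ik : i != k.
  by apply/eqP => ik; apply: (NE (p i)); rewrite ?ik; exact: segment_left.
have il : i != l.
  apply/eqP => il; apply: (NE (p i)); first exact: segment_left.
  by rewrite il; exact: segment_right.
have jk : j != k.
  apply/eqP => jk; apply: (NE (p j)); first exact: segment_right.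
  by rewrite jk; exact: segment_left.
have jl : j != l.
  by apply/eqP => jl; apply: (NE (p j)); rewrite ?jl; exact: segment_right.
have : (size [:: i; j; k; l] <= #|A|)%N.
  apply/card_geqP; exists [:: i; j; k; l]; split=> //.
    by rewrite /= !inE !negb_or ij ik il jk jl kl.
  by move=> x; rewrite !inE => /or4P[] /eqP->.
by rewrite A3.
Qed.

Lemma edges_zero_sum_disjoint (A B : {set T}) (s : segments V) :
  A \in zero_sum_triples T -> B \in zero_sum_triples T ->
  s \in edges A -> s \in edges B -> A = B.
Proof.
move=> AS BS /edgesP[i [j [iA jA ij sE]]] /edgesP[k [l [kB lB kl sE']]].
have pkl : p k != p l by rewrite (inj_eq p_inj).
have [ikl jkl] := @segment_endpoints_eq _ V _ _ _ _ Vgen (pV i) (pV j) (pV k)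
  (pV l) pkl (etrans (esym sE) sE').
have iB : i \in B by case: ikl => /p_inj ->.
have jB : j \in B by case: jkl => /p_inj ->.
exact: (zero_sum_triple_eq _ _ _ i j).
Qed.

(** Distinct triples share at most one element, so [A] has a side with both endpoints outside [B].
    The line through it misses the vertices of [B], and [triangle_edge_disjoint] gives a side of [B]
    disjoint from it. *)
Lemma edges_zero_sum_adj (A B : {set T}) :
  A \in zero_sum_triples T -> B \in zero_sum_triples T -> A != B ->
  exists s t, [/\ s \in edges A, t \in edges B & disjoint_segments s t].
Proof.
move=> AS BS AB.
have [A3 B3] : #|A| = 3%N /\ #|B| = 3%N.
  by move: AS BS; rewrite !inE => /andP[/eqP-> _] /andP[/eqP-> _].
have AB1 : (#|A :&: B|%SET <= 1)%N.
  rewrite leqNgt; apply/negP => /card_gt1P[i [j []]]; rewrite !inE.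
  move=> /andP[iA iB] /andP[jA jB] ij.
  by move/eqP: AB; apply; exact: (zero_sum_triple_eq _ _ _ i j).
have /card_gt1P[i [j []]] : (1 < #|A :\: B|%SET)%N.
  by rewrite cardsD A3; lia.
rewrite !inE => /andP[iB iA] /andP[jB jA] ij.
have /card_gt2P[x [y [z [[xB yB zB] [xy yz zx]]]]] : (2 < #|B|)%N by rewrite B3.
have [s sA sE] := edge_exists i j A iA jA ij.
have [t1 t1B t1E] := edge_exists x y B xB yB xy.
have [t2 t2B t2E] := edge_exists y z B yB zB yz.
have xz : x != z by rewrite eq_sym.
have [t3 t3B t3E] := edge_exists x z B xB zB xz.
have : uniq (map p [:: i; j; x; y; z]).
  have neq a b : a \notin B -> b \in B -> a != b.
    by move=> aB; apply: contraTneq => <-.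
  by rewrite map_inj_uniq //= !inE !negb_or ij xy yz xz !neq.
case/(triangle_edge_disjoint _ V) => // st; exists s.
- by exists t1; split=> //; apply/asboolP; rewrite sE t1E.
- by exists t2; split=> //; apply/asboolP; rewrite sE t2E.
- by exists t3; split=> //; apply/asboolP; rewrite sE t3E.
Qed.

Lemma card_zero_sum_triples_le_achromatic :
  (#|zero_sum_triples T| <= achromatic_number (@disjoint_segments R V))%N.
Proof.
rewrite -(card_sig (mem (zero_sum_triples T))).
pose E (A : {A | A \in zero_sum_triples T}) := edges (val A).
have c3 (A : {A | A \in zero_sum_triples T}) : #|val A| = 3%N.
  by have := valP A; rewrite inE => /andP[/eqP].
apply: (@achromatic_number_ge_family _ _ _ E).
- by move=> s t; apply/asboolP/asboolP; rewrite setIC.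
- move=> A; have /card_gt1P[i [j [iA jA ij]]] : (1 < #|val A|)%N by rewrite c3.
  by have [s sA _] := edge_exists i j _ iA jA ij; exists s.
- move=> A B s sA sB; apply: val_inj.
  exact: (edges_zero_sum_disjoint _ _ s (valP A) (valP B)).
- by move=> A s t; exact: edges_intersect.
- by move=> A B AB; exact: (edges_zero_sum_adj _ _ (valP A) (valP B)).
- move=> s; apply/asboolP; rewrite setIid.
  have /imfset2P[a _ [b _ ->]] := valP s => s0.
  by have : set0 a by rewrite -s0; exact: segment_left.
Qed.

End ZeroSumTriangles.

Theorem theorem7p4 (R : realType) :
  exists h : nat -> R,
    [/\ forall n : nat, 0 <= h n,
        (h : nat -> R^o) \is 'Theta_\oo (fun n : nat => n%:R : R^o)
      & forall (n : nat) (V : {fset plane R}),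
          #|` V| = n -> general_position V ->
          n%:R ^+ 2 / 6 - h n
            <= (achromatic_number (@disjoint_segments R V))%:R].
Proof.
(* The count of triples only loses n/2, so h(n) = n is ample. *)
exists (fun n => n%:R); split=> [n||n V Vn Vgen].
- exact: ler0n.
- by rewrite -eqThetaE; exact: idTheta.
(* The empty set is treated apart, because the group Z/n is carried by ['I_m.+1], with n = m + 1. *)
- case: n Vn => [|m] Vm; first by rewrite expr0n mul0r subr0 ler0n.
  pose p (i : 'I_m.+1) := nth 0 (enum_fset V) i.
  have sV (i : 'I_m.+1) : (i < size (enum_fset V))%N by rewrite (Vm : size _ = _).
  have pV i : p i \in V by rewrite /p mem_nth.
  have p_inj : injective p.
    move=> i j /eqP; rewrite nth_uniq ?fset_uniq// => /eqP.
    exact: val_inj.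
  have := card_zero_sum_triples_le_achromatic _ V _ p Vgen pV p_inj.
  have := card_zero_sum_triples ('I_m.+1 : finZmodType); rewrite card_ord.
  set k := #|_|; set N := m.+1; rewrite -!(ler_nat R) natrX natrD !natrM.
  have : 0 <= N%:R :> R by exact: ler0n.
  set a := achromatic_number _; lra.
Qed.
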